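(* Let $c_0\in\mathbb{R}$ and let $\gamma$ be the group $2$-cocycle $\gamma(g,h)=3c_0\int_{D^2}\mathrm{tr}(\theta_{D^2}(g)\wedge\theta_{D^2}(h^{-1}))$ of $\mathcal{G}=\mathrm{Diff}_{+\mathrm{ar}}(\overline{D^2})_0$. The Lie algebra $2$-cocycle $\beta$ of $\mathrm{Lie}(\mathcal{G})=\mathrm{Vect}_{\mathrm{ar}}(D^2)$ corresponding to $\gamma$, i.e. $$\beta(V,W)=\left.\frac{\partial^2}{\partial t\,\partial s}\left(\gamma(h_t,k_s)-\gamma(k_s,h_t)\right)\right|_{t=s=0},$$ where $\{h_t\}_{t\in(-\epsilon,\epsilon)}$ and $\{k_s\}_{s\in(-\epsilon,\epsilon)}$ are curves in $\mathcal{G}$ with $h_0=k_0=\mathrm{id}$, $\frac{d}{dt}h_t|_{t=0}=V$, $\frac{d}{ds}k_s|_{s=0}=W$, is given by $$\beta(V,W)=-6c_0\int_{D^2}\mathrm{tr}\left(dJ_{D^2}(V)\wedge dJ_{D^2}(W)\right)\qquad\forall\,V,W\in\mathrm{Vect}_{\mathrm{ar}}(D^2).$$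
   Context: $D^2$ is the open unit disc in $\mathbb{C}=\mathbb{R}^2$, $\overline{D^2}$ its closure, $S^1=\partial D^2$. $g\in\mathrm{Diff}_+(\overline{D^2})$ (orientation-preserving $C^\infty$ self-diffeomorphisms) is asymptotically radial if there are $\epsilon\in(0,1)$ and $f\in\mathrm{Diff}_+(S^1)$ with $g(re^{\mathrm{i}\theta})=re^{\mathrm{i}f(\theta)}$ for $r\in(1-\epsilon,1]$ and all $\theta$; these form the group $\mathrm{Diff}_{+\mathrm{ar}}(\overline{D^2})$, and $\mathcal{G}=\mathrm{Diff}_{+\mathrm{ar}}(\overline{D^2})_0$ is its subgroup of elements smoothly isotopic to the identity within it. For $\mathbb{R}^2$-valued maps $F=(F_1,F_2)$ on the disc, $J_{D^2}(F)=\begin{pmatrix}\partial_xF_1&\partial_yF_1\\ \partial_xF_2&\partial_yF_2\end{pmatrix}$; a vector field $V=V_1\frac{\partial}{\partial x}+V_2\frac{\partial}{\partial y}$ is regarded as the map $(V_1,V_2)$. For $g\in\mathcal{G}$, $\theta_{D^2}(g)=J_{D^2}(g)^{-1}dJ_{D^2}(g)$. $\wedge$ of matrix-valued forms combines matrix product and wedge product. $\mathrm{Vect}_{\mathrm{ar}}(D^2)$ is the Lie algebra of vector fields $V$ with $V_1,V_2\in C^\infty(D^2;\mathbb{R})$ extending continuously to $\overline{D^2}$ such that, writing $V=V_3\frac{\partial}{\partial r}+V_4\frac{\partial}{\partial\theta}$ in polar coordinates, $V_3|_{r=1}\equiv0$ and $\partial_rV_3\equiv0\equiv\partial_rV_4$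 on a neighborhood of $S^1$ in $\overline{D^2}$. Curves in $\mathcal{G}$ are $C^1$ for the usual $C^\infty$ structure (one may take $(t,z)\mapsto h_t(z)$ smooth on $(-\epsilon,\epsilon)\times\overline{D^2}$). *)

(* Defs.v *)
From mathcomp Require Import all_boot all_order all_algebra.
From mathcomp Require Import all_classical all_reals all_analysis.

Set Implicit Arguments.
Unset Strict Implicit.
Unset Printing Implicit Defensive.

Import Order.TTheory GRing.Theory Num.Theory.
Import numFieldNormedType.Exports.

Local Open Scope classical_set_scope.
Local Open Scope ring_scope.

Section Smooth.
Context {R : realType}.

(* In finite dimension, f is C^(n+1) iff it is differentiable and every
   x |-> 'D_v f x is C^n. *)
Fixpoint Cn_open (V W : normedModType R) (n : nat) (U : set V) (f : V -> W) :
    Prop :=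
  match n with
  | 0%N => forall x, U x -> {for x, continuous f}
  | m.+1 => (forall x, U x -> differentiable f x) /\
            (forall v : V, Cn_open m U ('D_v f))
  end.

Definition smooth_open (V W : normedModType R) (U : set V) (f : V -> W) :=
  forall n, Cn_open n U f.

(* Smoothness on an arbitrary subset A: near each point of A, f agrees on A
   with a smooth map defined on an open set. Values of f outside A are
   irrelevant. *)
Definition smooth_on (V W : normedModType R) (A : set V) (f : V -> W) :=
  forall x, A x -> exists (U : set V) (F : V -> W),
    [/\ open U, U x, smooth_open U F & forall y, U y -> A y -> F y = f y].

(* The inverse of a bijection f of A; its values outside A are irrelevant. *)
Definition inv_on (V : normedModType R) (A : set V) (f : V -> V) : V -> V :=
  'pinv_(fun=> 0) A f.

Definition diffeo (V : normedModType R) (A : set V) (f : V -> V) :=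
  [/\ set_bij A A f, smooth_on A f & smooth_on A (inv_on A f)].

End Smooth.

Section Disc.
Context {R : realType}.

Local Notation plane := (R * R)%type.

Definition disc : set plane := [set z | z.1 ^+ 2 + z.2 ^+ 2 < 1].
Definition cdisc : set plane := [set z | z.1 ^+ 2 + z.2 ^+ 2 <= 1].
Definition circle : set plane := [set z | z.1 ^+ 2 + z.2 ^+ 2 = 1].

Definition polar (r t : R) : plane := (r * cos t, r * sin t).

Definition pcoord (i : 'I_2) (z : plane) : R := if i == 0 then z.1 else z.2.

Definition ebase (j : 'I_2) : plane := if j == 0 then (1, 0) else (0, 1).

Definition jac (F : plane -> plane) (z : plane) : 'M[R]_2 :=
  \matrix_(i, j) 'D_(ebase j) (fun w => pcoord i (F w)) z.

Definition Diff_plus_cdisc (g : plane -> plane) :=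
  diffeo cdisc g /\ (forall z, disc z -> 0 < \det (jac g z)).

(* The orientation condition says that the velocity of t |-> phi(e^(it)) points
   counterclockwise, i.e. is a positive multiple of i * phi(e^(it)). *)
Definition Diff_plus_circle (phi : plane -> plane) :=
  diffeo circle phi /\
  forall t : R,
    let c := fun u => phi (polar 1 u) in
    0 < (c t).1 * derive1 (fun u => (c u).2) t - (c t).2 * derive1 (fun u => (c u).1) t.

(* An element f of Diff_+(S^1) acting on angles is represented by the map
   phi : e^(it) |-> e^(i f(t)) of the unit circle, so that
   r e^(i f(t)) = r *: phi (e^(it)). *)
Definition asymptotically_radial (g : plane -> plane) :=
  exists (eps : R) (phi : plane -> plane),
    [/\ 0 < eps < 1, Diff_plus_circle phi &
        forall r t : R, 1 - eps < r <= 1 ->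
          g (polar r t) = r *: phi (polar 1 t)].

Definition Diff_plus_ar (g : plane -> plane) :=
  Diff_plus_cdisc g /\ asymptotically_radial g.

Definition isotopic_to_id (g : plane -> plane) :=
  exists H : R -> plane -> plane,
    [/\ smooth_on (`[(0 : R), 1] `*` cdisc : set (R * plane)%type)
          (fun p => H p.1 p.2),
        forall t, 0 <= t <= 1 -> Diff_plus_ar (H t),
        forall z, cdisc z -> H 0 z = z &
        forall z, cdisc z -> H 1 z = g z].

Definition in_G (g : plane -> plane) := Diff_plus_ar g /\ isotopic_to_id g.

(* V stands for its continuous extension to the closed disc. The pair (V3, V4)
   consists of the components of V in the frame
   d/dr = (cos t, sin t), d/dt = (- r sin t, r cos t). *)
Definition Vect_ar (V : plane -> plane) :=
  [/\ smooth_open disc V, {within cdisc, continuous V} &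
      exists V3 V4 : R -> R -> R,
        [/\ forall r t : R, 0 < r <= 1 ->
              V (polar r t) = V3 r t *: (cos t, sin t)
                            + V4 r t *: (- (r * sin t), r * cos t),
            forall t, V3 1 t = 0 &
            exists2 d : R, 0 < d < 1 &
              forall r t : R, 1 - d < r < 1 ->
                is_derive r 1 (fun u => V3 u t) 0 /\
                is_derive r 1 (fun u => V4 u t) 0]].

Definition G_curve (eps : R) (h : R -> plane -> plane) (V : plane -> plane) :=
  [/\ smooth_on (`]- eps, eps[ `*` cdisc : set (R * plane)%type)
       (fun p => h p.1 p.2),
      forall t, - eps < t < eps -> in_G (h t),
      forall z, cdisc z -> h 0 z = z &
      forall z, disc z -> is_derive (0 : R) 1 (fun t => h t z) (V z)].

(* A form takes a point and then one tangent vector per degree. *)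
Definition mform1 := plane -> plane -> 'M[R]_2.
Definition mform2 := plane -> plane -> plane -> 'M[R]_2.

Definition dmx (A : plane -> 'M[R]_2) : mform1 := fun z v =>
  \matrix_(i, j) 'D_v (fun w => A w i j) z.

Definition wedge (a b : mform1) : mform2 := fun z u v =>
  a z u *m b z v - a z v *m b z u.

(* The integral over the disc, for the orientation dx /\ dy, of the trace of a
   matrix-valued 2-form. *)
Definition int_disc_tr (w : mform2) : R :=
  Rintegral (lebesgue_measure \x lebesgue_measure)%E disc
    (fun z => \tr (w z (ebase 0) (ebase 1))).

Definition theta (g : plane -> plane) : mform1 := fun z v =>
  invmx (jac g z) *m dmx (jac g) z v.

Definition gamma (c0 : R) (g h : plane -> plane) : R :=
  3%:R * c0 * int_disc_tr (wedge (theta g) (theta (inv_on cdisc h))).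

End Disc.

(* Main.v *)
Require Import Defs.
From HB Require Import structures.
From mathcomp Require Import all_boot all_order all_algebra.
From mathcomp Require Import all_classical all_reals all_analysis.
From mathcomp Require Import measurable_realfun measurable_fun_approximation.
From mathcomp Require Import ring lra.

Import Order.TTheory GRing.Theory Num.Theory.
Import numFieldNormedType.Exports.

Local Open Scope classical_set_scope.
Local Open Scope ring_scope.

Set Implicit Arguments.
Unset Strict Implicit.
Unset Printing Implicit Defensive.

(* Since h_0 = id, theta(h_t) = t dJ(V) + o(t), and only this first-order
   expansion matters.  For the inverse, put w = h_t^-1(z) and X = J(h_t)(w)^-1;
   differentiating J(h_t)(h_t^-1(z)) J(h_t^-1)(z) = 1 gives
     theta(h_t^-1)(z)(e_l) = - (sum_m X_ml d_m J(h_t)(w)) X,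
   hence theta(h_t^-1) = - t dJ(V) + o(t), and no regularity of t |-> h_t^-1 is
   needed beyond w -> z.  Both expansions hold pointwise and are dominated by
   C|t| uniformly on the disc, by compactness of the closed disc, so the
   derivatives in s and then in t pass under the integral sign by dominated
   convergence.  The two terms of F contribute equally because
   tr (A /\ B) = - tr (B /\ A). *)

(** Smoothness up to the boundary is given only through local extensions, and values outside the
    closed disc carry no information, so ['D_v] at a boundary point means nothing. Derivatives are
    therefore taken on the open cylinder over the disc, and compactness of the closed disc is
    applied to their local extensions. Asymptotic radiality enters through the boundary circle: it
    keeps the points h_t^-1(z) in the open disc, where [jac (h t)] is meaningful. One lemma on
    differentiation under the integral serves for both variables, because after the derivative in
    [s] there remain integrals of wedges with a single moving factor. *)

(** * Mean value theorem along lines, expansion in time, symmetry of second derivatives *)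

Section Calculus.
Context {R : realType}.
Implicit Types E P W : normedModType R.

Lemma derive_line E W (f : E -> W) (x v : E) (s : R) :
  'D_1 (fun r : R => f (r *: v + x)) s = 'D_v f (s *: v + x).
Proof.
rewrite /derive; set g1 := fun h => _; set g2 := fun h => h^-1 *: _.
suff -> : g1 = g2 by [].
apply/funext => h; rewrite /g1 /g2 /=.
by rewrite [h%:A]mulr1 scalerDl addrA.
Qed.

Lemma derivable_line E W (f : E -> W) (x v : E) (s : R) :
  derivable f (s *: v + x) v <-> derivable (fun r : R => f (r *: v + x)) s 1.
Proof.
rewrite /derivable; set g1 := fun h => _; set g2 := fun h => h^-1 *: _.
suff -> : g1 = g2 by [].
apply/funext => h; rewrite /g1 /g2 /=.
by rewrite [h%:A]mulr1 scalerDl addrA.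
Qed.

Lemma is_derive_line E W (f : E -> W) (x v : E) (s : R) (d : W) :
  is_derive (s *: v + x) v f d -> is_derive s 1 (fun r : R => f (r *: v + x)) d.
Proof.
by move=> [df <-]; split; [exact/derivable_line|exact: derive_line].
Qed.

Lemma derive_shiftv E W (f : E -> W) (a x v : E) :
  'D_v (fun y => f (a + y)) x = 'D_v f (a + x).
Proof.
rewrite /derive; set g1 := fun h => _; set g2 := fun h => h^-1 *: _.
suff -> : g1 = g2 by [].
by apply/funext => h; rewrite /g1 /g2 /= addrCA.
Qed.

Lemma is_derive_shiftv E W (f : E -> W) (a x v : E) (d : W) :
  is_derive (a + x) v f d -> is_derive x v (fun y => f (a + y)) d.
Proof.
move=> [df <-]; split; last exact: derive_shiftv.
move: df; rewrite /derivable; set g1 := fun h => _; set g2 := fun h => h^-1 *: _.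
suff -> : g1 = g2 by [].
by apply/funext => h; rewrite /g1 /g2 /= addrCA.
Qed.

Lemma MVT_line E (f : E -> R) (df : R -> R) (x v : E) (h : R) :
  (forall s : R, `|s| <= `|h| -> is_derive (s *: v + x) v f (df s)) ->
  exists2 c, `|c| <= `|h| & f (h *: v + x) - f x = h * df c.
Proof.
move=> fdf; pose F (s : R) := f (s *: v + x).
have dF (s : R) : `|s| <= `|h| -> is_derive s 1 F (df s).
  by move=> sh; apply: is_derive_line; exact: fdf.
have F0 : F 0 = f x by rewrite /F scale0r add0r.
rewrite -F0 -/(F h).
have cF (a b : R) : (forall s, s \in `[a, b] -> `|s| <= `|h|) ->
    {within `[a, b], continuous F}.
  move=> H; apply: derivable_within_continuous => s /H sh.
  exact: (@ex_derive _ _ _ _ _ _ _ (dF _ sh)).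
have [h0|h0] := leP 0 h.
- have H (s : R) : s \in `[0, h] -> `|s| <= `|h|.
    by rewrite in_itv/= => /andP[? ?]; rewrite !ger0_norm.
  have [|c c0h ->] := MVT_segment (df := df) h0 _ (cF _ _ H).
    by move=> s /subset_itv_oo_cc /H; exact: dF.
  by exists c; [exact: H|rewrite subr0 mulrC].
- have H (s : R) : s \in `[h, 0] -> `|s| <= `|h|.
    by rewrite in_itv/= => /andP[? ?]; rewrite !ler0_norm ?lerN2 // ltW.
  have [|c c0h FE] := MVT_segment (df := df) (ltW h0) _ (cF _ _ H).
    by move=> s /subset_itv_oo_cc /H; exact: dF.
  by exists c; [exact: H|rewrite -opprB FE sub0r mulrN opprK mulrC].
Qed.

(** By the mean value theorem in time, the increment from [(0, z)] to [(t, z)] is [t] times the time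
    derivative at an intermediate point, which continuity puts within [e] of its value at [(0, x)].
    The coefficient is frozen at [x] while [z] varies, so the expansion may be used along moving
    base points. *)
Lemma time_taylor P (q : R * P -> R) (U : set (R * P)) (x : P) (e : R) :
  open U -> U (0, x) -> (forall p, U p -> differentiable q p) ->
  {for (0, x), continuous ('D_((1 : R), (0 : P)) q)} -> 0 < e ->
  \forall p \near ((0 : R), x),
    `|q p - q (0, p.2) - p.1 * 'D_((1 : R), (0 : P)) q (0, x)| <= e * `|p.1|.
Proof.
move=> oU Ux dq cq e0.
have : \forall p \near ((0 : R), x), U p /\
    `|'D_((1 : R), (0 : P)) q (0, x) - 'D_((1 : R), (0 : P)) q p| <= e.
  apply: filterI; first exact: open_nbhs_nbhs.
  by move/cvgrPdist_le : cq => /(_ _ e0).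
move=> /nbhs_ballP[r /= r0 rU]; apply/nbhs_ballP; exists r => // -[t z] [/= tr zr].
have inU (s : R) : `|s| <= `|t| -> ball ((0 : R), x) r (s, z).
  move=> st; split => //=; move: tr; rewrite -!ball_normE/= !sub0r !normrN.
  exact: le_lt_trans.
have sE (s : R) : s *: ((1 : R), (0 : P)) + (0, z) = (s, z).
  apply: injective_projections => /=; first by rewrite [s%:A]mulr1 addr0.
  by rewrite scaler0 add0r.
have [|c ct] := @MVT_line _ q (fun s => 'D_((1 : R), (0 : P)) q (s, z))
    (0, z) (1, 0) t.
  move=> s /inU/rU[Us _]; rewrite sE.
  by apply: derivableP; apply: diff_derivable; exact: dq.
rewrite sE => ->; rewrite -mulrBr normrM mulrC ler_wpM2r//.
by rewrite distrC; have [_] := rU _ (inU _ ct).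
Qed.

(* The second difference of [f] along [h u], [h v] equals [h^2] times either
   mixed derivative at some point near [x], by two uses of the mean value
   theorem in each order. *)
Lemma derive_comm E (f : E -> R) (U : set E) (x u v : E) :
  open U -> U x -> (forall y, U y -> differentiable f y) ->
  (forall y, U y -> differentiable ('D_u f) y) ->
  (forall y, U y -> differentiable ('D_v f) y) ->
  {for x, continuous ('D_v ('D_u f))} -> {for x, continuous ('D_u ('D_v f))} ->
  'D_v ('D_u f) x = 'D_u ('D_v f) x.
Proof.
move=> oU Ux df du dv cvu cuv.
have second_difference (a b : E) (h : R) :
    (forall y, U y -> differentiable ('D_a f) y) ->
    (forall s r : R, `|s| <= `|h| -> `|r| <= `|h| ->
       U (s *: b + (r *: a + x))) ->
  exists s r, [/\ `|s| <= `|h|, `|r| <= `|h| &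
   f (h *: b + (h *: a + x)) - f (h *: a + x) - (f (h *: b + x) - f x) =
   h * (h * 'D_b ('D_a f) (s *: b + (r *: a + x)))].
  move=> da hU.
  have U0 (r : R) : `|r| <= `|h| -> U (r *: a + x).
    by move=> rh; have := hU 0 r; rewrite scale0r add0r normr0; exact.
  have [|r rh ->] := @MVT_line _ (fun y => f (h *: b + y) - f y)
     (fun r => 'D_a f (h *: b + (r *: a + x)) - 'D_a f (r *: a + x)) x a h.
    move=> r rh; apply: is_deriveB.
      apply: is_derive_shiftv; apply: derivableP; apply: diff_derivable.
      by apply: df; exact: hU.
    by apply: derivableP; apply: diff_derivable; apply: df; exact: U0.
  have [|s sh ->] := @MVT_line _ ('D_a f)
     (fun s => 'D_b ('D_a f) (s *: b + (r *: a + x))) (r *: a + x) b h.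
    move=> s sh; apply: derivableP; apply: diff_derivable.
    by apply: da; exact: hU.
  by exists s, r.
apply/eqP; rewrite -subr_eq0 -normr_le0; apply/ler_addgt0Pl => e e0.
have e20 : 0 < e / 2 by rewrite divr_gt0.
have : \forall y \near x, U y /\ (`|'D_v ('D_u f) x - 'D_v ('D_u f) y| <= e / 2
    /\ `|'D_u ('D_v f) x - 'D_u ('D_v f) y| <= e / 2).
  apply: filterI; first exact: open_nbhs_nbhs.
  apply: filterI; first by move/cvgrPdist_le : cvu; exact.
  by move/cvgrPdist_le : cuv; exact.
move=> /nbhs_ballP[r /= r0 rU].
(* With this [h], every point used lies within [h * N = r / 2] of [x]; the summand 1 keeps [N]
   positive when [u] and [v] vanish. *)
pose N := `|u| + `|v| + 1.
have N0 : 0 < N by rewrite /N ltr_wpDl// addr_ge0.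
pose h := r / 2 / N.
have h0 : 0 < h by rewrite !divr_gt0.
have inb (s t : R) : `|s| <= `|h| -> `|t| <= `|h| -> ball x r (s *: v + (t *: u + x)).
  rewrite (gtr0_norm h0) => sh th; rewrite -ball_normE/=.
  rewrite addrA opprD addrCA subrr addr0 normrN.
  rewrite (@le_lt_trans _ _ (h * N))//; last first.
    by rewrite /h divfK ?gt_eqF// ltr_pdivrMr// ltr_pMr// ltr1n.
  rewrite (le_trans (ler_normD _ _))// !normrZ /N.
  have := ler_wpM2r (normr_ge0 v) sh; have := ler_wpM2r (normr_ge0 u) th.
  by rewrite !mulrDr mulr1; lra.
clearbody h.
have [|s [t [sh th E1]]] := @second_difference u v h du.
  by move=> s t sh th; have [] := rU _ (inb _ _ sh th).
have inb' (a b : R) : `|a| <= `|h| -> `|b| <= `|h| ->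
    ball x r (a *: u + (b *: v + x)).
  by move=> ? ?; rewrite addrCA; exact: inb.
have [|s' [t' [sh' th' E2]]] := @second_difference v u h dv.
  by move=> s' t' sh' th'; have [] := rU _ (inb' _ _ sh' th').
have E3 : 'D_v ('D_u f) (s *: v + (t *: u + x)) =
          'D_u ('D_v f) (s' *: u + (t' *: v + x)).
  apply: (mulfI (lt0r_neq0 h0)); apply: (mulfI (lt0r_neq0 h0)).
  have fC : f (h *: u + (h *: v + x)) = f (h *: v + (h *: u + x)).
    by congr f; exact: addrCA.
  apply: etrans (etrans (esym E1) _) E2; rewrite fC.
  move: (f (h *: v + (h *: u + x))) (f (h *: u + x)) (f (h *: v + x)) (f x).
  by move=> a b c d; rewrite !opprB [LHS]addrACA [in RHS]addrACA [- c - b]addrC.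
have [_ [A _]] := rU _ (inb _ _ sh th); have [_ [_ B]] := rU _ (inb' _ _ sh' th').
rewrite addr0; rewrite E3 in A; move: A B.
move: ('D_v ('D_u f) x) ('D_u ('D_v f) x) ('D_u ('D_v f) _) => a b c.
by clear; have := ler_distD c a b; rewrite (distrC c b); lra.
Qed.

End Calculus.

(** * Smoothness on open sets, and smooth extension to boundary points *)

Section Smoothness.
Context {R : realType}.
Implicit Types V W : normedModType R.

(** The difference [g - f] vanishes near [x], hence is little-o with zero differential. *)
Lemma near_eq_differentiable V W (f g : V -> W) (x : V) :
  {near x, f =1 g} -> differentiable f x -> differentiable g x.
Proof.
move=> fg df; pose k := g \- f.
suff dk : differentiable k x.
  have -> : g = f + k by apply/funext => y; rewrite /k /= addrC subrK.
  exact: differentiableD.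
have kx : k x = 0 by rewrite /k /= (nbhs_singleton fg) subrr.
have k0 : k \o shift x = cst (k x) + (\0 : V -> W) +o_ 0 id.
  apply/eqaddoP => _/posnumP[e]; rewrite kx.
  have := fg; rewrite [X in X -> _](near_shift 0)/=.
  apply: filterS => h /=; rewrite subr0 => fgh.
  rewrite !fctE /= /k /= fgh subrr addr0 subr0 normr0.
  by rewrite mulr_ge0.
have c0 : continuous (\0 : V -> W) by exact: cst_continuous.
by apply/diff_locallyP; rewrite (diff_unique c0 k0).
Qed.

Lemma derive_eq_on V W (U : set V) (f g : V -> W) (x v : V) :
  open U -> U x -> (forall y, U y -> f y = g y) -> 'D_v f x = 'D_v g x.
Proof.
move=> oU Ux fg; apply: near_eq_derive.
have : \forall y \near x, U y by exact: open_nbhs_nbhs.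
exact: filterS.
Qed.

Lemma Cn_open_local V W n (O : set V) (f : V -> W) :
  (forall x, O x -> exists U, [/\ open U, U x & Cn_open n U f]) ->
  Cn_open n O f.
Proof.
elim: n f => [|n IH] f fO /=.
  by move=> x /fO[U [_ Ux]]; exact.
split; first by move=> x /fO[U [_ Ux []]]; move/(_ _ Ux).
by move=> v; apply: IH => x /fO[U [oU Ux [_ /(_ v) ?]]]; exists U.
Qed.

Lemma Cn_open_eq V W n (U : set V) (f g : V -> W) :
  open U -> (forall x, U x -> f x = g x) -> Cn_open n U f -> Cn_open n U g.
Proof.
move=> oU; elim: n f g => [|n IH] f g fg /=.
  move=> cf x Ux; have nfg : \forall y \near x, f y = g y.
    have : \forall y \near x, U y by exact: open_nbhs_nbhs.
    exact: filterS.
  change (g @ x --> g x); rewrite -fg//.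
  by apply: cvg_trans (cf _ Ux); exact: near_eq_cvg.
move=> [df Df]; split.
  move=> x Ux; apply: near_eq_differentiable (df _ Ux).
  have : \forall y \near x, U y by exact: open_nbhs_nbhs.
  exact: filterS.
by move=> v; apply: IH (Df v) => x Ux; exact: derive_eq_on fg.
Qed.

Lemma Cn_openW V W n (U O : set V) (f : V -> W) :
  O `<=` U -> Cn_open n U f -> Cn_open n O f.
Proof.
move=> OU; elim: n f => [|n IH] f /=; first by move=> cf x /OU; exact: cf.
by move=> [df Df]; split=> [x /OU|v]; [exact: df|exact: IH].
Qed.

Lemma smooth_open_eq V W (U : set V) (f g : V -> W) :
  open U -> (forall x, U x -> f x = g x) -> smooth_open U f -> smooth_open U g.
Proof. by move=> oU fg sf n; apply: Cn_open_eq (sf n). Qed.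

Lemma smooth_open_derive V W (U : set V) (f : V -> W) (v : V) :
  smooth_open U f -> smooth_open U ('D_v f).
Proof. by move=> sf n; have [_] := sf n.+1; apply. Qed.

Lemma smooth_open_differentiable V W (U : set V) (f : V -> W) x :
  smooth_open U f -> U x -> differentiable f x.
Proof. by move=> sf; have [+ _] := sf 1%N; apply. Qed.

Lemma smooth_open_continuous V W (U : set V) (f : V -> W) x :
  smooth_open U f -> U x -> {for x, continuous f}.
Proof. by move=> sf; have := sf 0%N; apply. Qed.

(** A continuous linear map commutes with ['D_v], so the induction closes without a chain rule for
    higher derivatives. It is applied to the coordinate projections. *)
Lemma smooth_open_linear V W (W' : normedModType R) (l : {linear W -> W'})
    (U : set V) (f : V -> W) :
  continuous l -> open U -> smooth_open U f -> smooth_open U (l \o f).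
Proof.
move=> cl oU sf n.
have dl y : differentiable l y by exact: linear_differentiable.
elim: n f sf => [|n IH] f sf /=.
  move=> x Ux; apply: continuous_comp; last exact: cl.
  exact: smooth_open_continuous Ux.
split=> [x Ux|v].
  by apply: differentiable_comp => //; exact: smooth_open_differentiable Ux.
apply: (@Cn_open_eq _ _ _ _ (l \o 'D_v f)) => //; last first.
  by apply: IH; exact: smooth_open_derive.
move=> x Ux.
have dfx := smooth_open_differentiable sf Ux.
rewrite [RHS]deriveE; last exact: differentiable_comp.
by rewrite diff_comp//= diff_lin// deriveE.
Qed.

Lemma derive_commute V (U : set V) (f : V -> R) (x u v : V) :
  open U -> smooth_open U f -> U x -> 'D_v ('D_u f) x = 'D_u ('D_v f) x.
Proof.
move=> oU sf Ux; apply: (derive_comm oU Ux).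
- by move=> y; exact: smooth_open_differentiable.
- by move=> y; apply: smooth_open_differentiable; exact: smooth_open_derive.
- by move=> y; apply: smooth_open_differentiable; exact: smooth_open_derive.
- by apply: smooth_open_continuous Ux; do 2 apply: smooth_open_derive.
- by apply: smooth_open_continuous Ux; do 2 apply: smooth_open_derive.
Qed.

(* For [O] open this is stable under differentiation, unlike [smooth_on] with a
   set [A] that is not open; [K] is meant to contain boundary points of [O]. *)
Definition extends_smoothly V W (O K : set V) (f : V -> W) :=
  forall x, K x -> exists (U : set V) (F : V -> W),
    [/\ open U, U x, smooth_open U F & forall y, U y -> O y -> F y = f y].

Lemma smooth_on_extends V W (A O : set V) (f : V -> W) :
  O `<=` A -> smooth_on A f -> extends_smoothly O A f.
Proof.
move=> OA sf x Ax; have [U [F [oU Ux sF Ff]]] := sf x Ax.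
by exists U, F; split => // y Uy /OA; exact: Ff.
Qed.

Lemma extends_derive V W (O K : set V) (f : V -> W) (v : V) :
  open O -> extends_smoothly O K f -> extends_smoothly O K ('D_v f).
Proof.
move=> oO fK x /fK[U [F [oU Ux sF Ff]]]; exists U, ('D_v F); split => //.
  exact: smooth_open_derive.
move=> y Uy Oy; apply: (@derive_eq_on _ _ (U `&` O)) => //; first exact: openI.
by move=> z [Uz Oz]; exact: Ff.
Qed.

Lemma extends_linear V W (W' : normedModType R) (l : {linear W -> W'})
    (O K : set V) (f : V -> W) :
  continuous l -> extends_smoothly O K f -> extends_smoothly O K (l \o f).
Proof.
move=> cl fK x /fK[U [F [oU Ux sF Ff]]]; exists U, (l \o F); split => //.
  exact: smooth_open_linear.
by move=> y Uy Oy; rewrite /= Ff.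
Qed.

Lemma extends_smooth_open V W (O K : set V) (f : V -> W) :
  open O -> O `<=` K -> extends_smoothly O K f -> smooth_open O f.
Proof.
move=> oO OK fK n; apply: Cn_open_local => x Ox.
have [U [F [oU Ux sF Ff]]] := fK x (OK _ Ox).
exists (U `&` O); split => //; first exact: openI.
apply: (@Cn_open_eq _ _ _ _ F); first exact: openI.
  by move=> y [Uy Oy]; exact: Ff.
by apply: Cn_openW (sF n); exact: subIsetl.
Qed.

Lemma smooth_on_open V W (A O : set V) (f : V -> W) :
  open O -> O `<=` A -> smooth_on A f -> smooth_open O f.
Proof.
by move=> oO OA /(smooth_on_extends OA); exact: extends_smooth_open.
Qed.

End Smoothness.

(** * Coordinates of the plane; topology of the disc *)

Section PlaneCoordinates.
Context {R : realType}.
Local Notation plane := (R * R)%type.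

Lemma pcoord_is_linear (i : 'I_2) : linear (@pcoord R i).
Proof. by move=> a u v; rewrite /pcoord; case: ifP. Qed.

HB.instance Definition _ (i : 'I_2) :=
  GRing.isLinear.Build R plane R *:%R (pcoord i) (pcoord_is_linear i).

Lemma pcoord_continuous (i : 'I_2) : continuous (@pcoord R i).
Proof.
by move=> z; rewrite /pcoord; case: (i == 0); [apply: cvg_fst|apply: cvg_snd].
Qed.

Lemma pcoord_ebase (i j : 'I_2) : pcoord i (@ebase R j) = (i == j)%:R.
Proof. by case: i => [[|[|i]] Hi] //; case: j => [[|[|j]] Hj]. Qed.

Lemma plane_sum (z : plane) : z = z.1 *: ebase 0 + z.2 *: ebase 1.
Proof.
apply: injective_projections => /=.
  by rewrite [_%:A]mulr1 scaler0 addr0.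
by rewrite [_%:A]mulr1 scaler0 add0r.
Qed.

Lemma continuous_sqnorm : continuous (fun z : plane => z.1 ^+ 2 + z.2 ^+ 2).
Proof.
move=> z; apply: cvgD.
  apply: (@continuous_cvg _ _ _ _ _ fst (fun x : R => x ^+ 2)).
    exact: exprn_continuous.
  by apply: cvg_fst.
apply: (@continuous_cvg _ _ _ _ _ snd (fun x : R => x ^+ 2)).
  exact: exprn_continuous.
by apply: cvg_snd.
Qed.

Lemma open_disc : open (@disc R).
Proof.
rewrite (_ : disc = (fun z : plane => z.1 ^+ 2 + z.2 ^+ 2) @^-1` [set x | x < 1])//.
by apply: open_comp => [z _|]; [exact: continuous_sqnorm|exact: open_lt].
Qed.

Lemma compact_cdisc : compact (@cdisc R).
Proof.
have cQ : compact ((`[(-1), 1] : set R) `*` (`[(-1), 1] : set R)).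
  by apply: compact_setX; exact: segment_compact.
apply: subclosed_compact cQ _.
- rewrite (_ : cdisc = (fun z : plane => z.1 ^+ 2 + z.2 ^+ 2) @^-1` [set x | x <= 1])//.
  by apply: preimage_closed => [z _|]; [exact: continuous_sqnorm|exact: closed_le].
- move=> z; rewrite /cdisc/= => z1; rewrite !in_itv/=.
  by split; apply/andP; split; nra.
Qed.

Lemma disc_cdisc : @disc R `<=` cdisc.
Proof. by move=> z; exact: ltW. Qed.

End PlaneCoordinates.

(** * Space and time derivatives as directional derivatives on the product *)

Section Slices.
Context {R : realType}.
Implicit Types P W : normedModType R.

Lemma derive_slice P W (f : R * P -> W) (t : R) (z v : P) :
  'D_((0 : R), v) f (t, z) = 'D_v (fun w => f (t, w)) z.
Proof.
rewrite /derive; set g1 := fun h => _; set g2 := fun h => h^-1 *: _.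
suff -> : g1 = g2 by [].
apply/funext => a; rewrite /g1 /g2 /=; congr (_ *: (f _ - _)).
by apply: injective_projections => //=; rewrite scaler0 add0r.
Qed.

Lemma derive_time P W (f : R * P -> W) (t : R) (z : P) :
  'D_((1 : R), (0 : P)) f (t, z) = 'D_1 (fun s => f (s, z)) t.
Proof.
rewrite /derive; set g1 := fun h => _; set g2 := fun h => h^-1 *: _.
suff -> : g1 = g2 by [].
apply/funext => a; rewrite /g1 /g2 /=; congr (_ *: (f _ - _)).
by apply: injective_projections => //=; rewrite scaler0 add0r.
Qed.

End Slices.

(** * Estimates along a curve of diffeomorphisms, uniform on the disc or near a point *)

Section CurveEstimates.
Context {R : realType}.
Local Notation plane := (R * R)%type.
Variables (eps : R) (eps_gt0 : 0 < eps).

Let O : set (R * plane) := `]- eps, eps[ `*` disc.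
Let K : set (R * plane) := `]- eps, eps[ `*` cdisc.

Lemma open_cylinder : open O.
Proof.
have oI : open (fst @^-1` `]- eps, eps[ : set (R * plane)).
  by apply: open_comp => [p _|]; [apply: cvg_fst|exact: interval_open].
have oD : open (snd @^-1` disc : set (R * plane)).
  by apply: open_comp => [p _|]; [apply: cvg_snd|exact: open_disc].
exact: openI oI oD.
Qed.

Lemma cylinder_sub : O `<=` K.
Proof. by move=> p [p1 p2]; split => //; exact: disc_cdisc. Qed.

Lemma cylinder0 (z : plane) : disc z -> O (0, z).
Proof. by move=> Dz; split => //=; rewrite in_itv/= oppr_lt0 eps_gt0. Qed.

Lemma cylinder_near (t : R) (z : plane) : `|t| < eps -> disc z -> O (t, z).
Proof. by move=> te Dz; split => //=; rewrite in_itv/= -ltr_norml. Qed.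

(** Near each point of the closed disc, possibly on the boundary, the first-order expansion of a
    local extension gives a Lipschitz bound in time; compactness makes it uniform. Asking for all
    large [C] lets several such bounds share one constant. *)
Lemma uniform_time_bound (q : R * plane -> R) :
  extends_smoothly O K q ->
  \forall C \near +oo, \forall t \near (0 : R), forall z, disc z ->
    `|q (t, z) - q (0, z)| <= C * `|t|.
Proof.
move=> qK.
pose B (i : R * R) (z : plane) :=
  disc z -> `|q (i.1, z) - q (0, z)| <= i.2 * `|i.1|.
(* The product filter lets a single compactness argument choose the time range and the constant
   together. *)
suff [[/= A1 A2] [A1t A2C] AB] : \forall i \near filter_prod (nbhs (0 : R)) +oo,
    forall z, cdisc z -> B i z.
  apply: filterS A2C => C A2C; apply: filterS A1t => t A1t z Dz.
  by apply: (AB (t, C)) => //; exact: disc_cdisc.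
apply: (iffLR (compact_near_coveringP (@cdisc R)) (@compact_cdisc R)) => x Kx.
have [|U [F [oU Ux sF Fq]]] := qK (0, x).
  by split => //=; rewrite in_itv/= oppr_lt0 eps_gt0.
set d := 'D_((1 : R), (0 : plane)) F (0, x).
(* Error [e = 1] suffices: the local constant is then [|d| + 1]. *)
have := @time_taylor _ _ F U x 1 oU Ux
  (fun p => @smooth_open_differentiable _ _ _ _ _ _ sF)
  (smooth_open_continuous (smooth_open_derive _ sF) Ux) ltr01.
move=> T; have : \forall p \near ((0 : R), x), U p /\
    `|F p - F (0, p.2) - p.1 * d| <= 1 * `|p.1|.
  by apply: filterI => //; exact: open_nbhs_nbhs.
move=> /nbhs_ballP[r /= r0 rU].
near=> z i => Dz.
have tr : ball (0 : R) r i.1.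
  near: i; apply: (@cvg_fst _ _ (nbhs (0 : R)) +oo).
  exact: nbhsx_ballx.
have te : `|i.1| < eps.
  suff : ball (0 : R) eps i.1 by rewrite -ball_normE/= sub0r normrN.
  near: i; apply: (@cvg_fst _ _ (nbhs (0 : R)) +oo).
  exact: nbhsx_ballx.
have iC : `|d| + 1 <= i.2.
  near: i; have := nbhs_pinfty_ge (num_real (`|d| + 1)).
  exact: cvg_snd.
have zr : ball x r z by near: z; exact: nbhsx_ballx.
have [Uz Tz] := rU (i.1, z) (conj tr zr).
have [U0 _] := rU (0, z) (conj (ballxx _ r0) zr).
rewrite -!Fq//; [|exact: cylinder0|exact: cylinder_near].
move: Tz iC; rewrite /= mul1r => Tz iC.
have := ler_normD (F (i.1, z) - F (0, z) - i.1 * d) (i.1 * d).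
rewrite subrK normrM => /le_trans; apply.
rewrite (@le_trans _ _ ((`|d| + 1) * `|i.1|))//; last by rewrite ler_wpM2r.
by rewrite mulrDl mul1r addrC mulrC lerD.
Unshelve. all: by end_near. Qed.

Lemma local_time_taylor (q : R * plane -> R) (z : plane) (e : R) :
  smooth_open O q -> disc z -> 0 < e ->
  \forall p \near ((0 : R), z),
   `|q p - q (0, p.2) - p.1 * 'D_((1 : R), (0 : plane)) q (0, z)| <= e * `|p.1|.
Proof.
move=> sq Dz; apply: (@time_taylor _ _ q O).
- exact: open_cylinder.
- exact: cylinder0.
- by move=> p; exact: smooth_open_differentiable.
- by apply: (smooth_open_continuous (smooth_open_derive _ sq)); exact: cylinder0.
Qed.

Variables (h : R -> plane -> plane) (V : plane -> plane).
Hypothesis hh : G_curve eps h V.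

(** Space derivatives are formed on [R * plane], along [(0, ebase j)], so that they can be exchanged
    with the time derivative, along [(1, 0)]. *)
Let hc (i : 'I_2) (p : R * plane) : R := pcoord i (h p.1 p.2).

Let Jc (i j : 'I_2) := 'D_((0 : R), @ebase R j) (hc i).

Let Hc (i j l : 'I_2) := 'D_((0 : R), @ebase R l) (Jc i j).

Let hc_extends i : extends_smoothly O K (hc i).
Proof.
have [sh _ _ _] := hh.
apply: (extends_linear (l := @pcoord R i) (f := fun p => h p.1 p.2)).
  exact: pcoord_continuous.
by apply: smooth_on_extends sh; exact: cylinder_sub.
Qed.

Let Jc_extends i j : extends_smoothly O K (Jc i j).
Proof. exact: (extends_derive _ open_cylinder (hc_extends i)). Qed.

Let Hc_extends i j l : extends_smoothly O K (Hc i j l).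
Proof. exact: (extends_derive _ open_cylinder (Jc_extends i j)). Qed.

Let hc_smooth i : smooth_open O (hc i).
Proof.
exact: (extends_smooth_open open_cylinder cylinder_sub (hc_extends i)).
Qed.

Let JcE i j t z : Jc i j (t, z) = jac (h t) z i j.
Proof. by rewrite /Jc derive_slice mxE. Qed.

Let HcE i j l t z : Hc i j l (t, z) = dmx (jac (h t)) z (ebase l) i j.
Proof.
rewrite /Hc derive_slice mxE; apply: (congr1 (fun f => 'D_(ebase l) f z)).
by apply/funext => w; exact: JcE.
Qed.

Let Jc0 i j z : disc z -> Jc i j (0, z) = (i == j)%:R.
Proof.
move=> Dz; have [_ _ h0 _] := hh.
rewrite /Jc derive_slice -(pcoord_ebase i j).
rewrite (@derive_eq_on _ _ _ disc _ (pcoord i))//; [|exact: open_disc|].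
- have dp : differentiable (@pcoord R i) z.
    by apply: linear_differentiable; exact: pcoord_continuous.
  by rewrite deriveE// diff_lin//; exact: pcoord_continuous.
- by move=> y Dy; rewrite /hc/= h0//; exact: disc_cdisc.
Qed.

Let Hc0 i j l z : disc z -> Hc i j l (0, z) = 0.
Proof.
move=> Dz; rewrite /Hc derive_slice.
rewrite (@derive_eq_on _ _ _ disc _ (cst ((i == j)%:R : R)))//; last first.
- by move=> y Dy; rewrite Jc0.
- exact: open_disc.
- by rewrite derive_cst.
Qed.

(* The time derivative at [0] is moved inside the two space derivatives by
   symmetry of second derivatives. *)
Let Hc_time i j l z : disc z ->
  'D_((1 : R), (0 : plane)) (Hc i j l) (0, z) = dmx (jac V) z (ebase l) i j.
Proof.
move=> Dz; have [_ _ _ hV] := hh.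
have O0 : O (0, z) by exact: cylinder0.
have sJ : smooth_open O (Jc i j) by exact: smooth_open_derive.
rewrite /Hc (derive_commute _ _ open_cylinder sJ O0).
pose g := 'D_((0 : R), @ebase R j) ('D_((1 : R), (0 : plane)) (hc i)).
transitivity ('D_((0 : R), @ebase R l) g (0, z)).
  apply: (derive_eq_on _ open_cylinder O0) => y Oy.
  exact: (derive_commute _ _ open_cylinder (hc_smooth i) Oy).
rewrite derive_slice mxE; apply: (derive_eq_on _ open_disc Dz).
move=> w Dw; rewrite /g derive_slice mxE; apply: (derive_eq_on _ open_disc Dw).
move=> y Dy; rewrite derive_time /hc/=.
have [dh <-] := hV _ Dy.
have dh' : differentiable (fun t => h t y) 0 by exact/derivable1_diffP.
have cp := @pcoord_continuous R i.
have dp x : differentiable (@pcoord R i) x by exact: linear_differentiable.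
have E := diff_comp dh' (dp (h 0 y)).
rewrite [LHS]deriveE; last exact: (differentiable_comp dh' (dp (h 0 y))).
by rewrite [X in X _ = _]E/= diff_lin// deriveE.
Qed.

Lemma curve_C0_bound : \forall C \near +oo, \forall t \near (0 : R),
  forall z, disc z -> `|h t z - z| <= C * `|t|.
Proof.
have [_ _ h0 _] := hh.
apply: filterS2 (uniform_time_bound (hc_extends 0))
  (uniform_time_bound (hc_extends 1)) => C C0 C1.
apply: filterS2 C0 C1 => t C0 C1 z Dz.
have := C0 z Dz; have := C1 z Dz; rewrite /hc/= !h0; try exact: disc_cdisc.
move=> b1 b0; rewrite prod_normE.
by rewrite ge_max; apply/andP; split.
Qed.

Lemma curve_jac_bound i j : \forall C \near +oo, \forall t \near (0 : R),
  forall z, disc z -> `|(jac (h t) z - 1%:M) i j| <= C * `|t|.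
Proof.
apply: filterS (uniform_time_bound (Jc_extends i j)) => C.
apply: filterS => t Ct z Dz; have := Ct z Dz.
by rewrite JcE Jc0// !mxE.
Qed.

Lemma curve_djac_bound i j l : \forall C \near +oo, \forall t \near (0 : R),
  forall z, disc z -> `|dmx (jac (h t)) z (ebase l) i j| <= C * `|t|.
Proof.
apply: filterS (uniform_time_bound (Hc_extends i j l)) => C.
apply: filterS => t Ct z Dz; have := Ct z Dz.
by rewrite HcE Hc0// subr0.
Qed.

(** The constant term is absent since [jac (h 0)] is the identity matrix on the disc. The expansion
    is joint in time and base point, as the inverse curve requires. *)
Lemma curve_djac_taylor i j l z e : disc z -> 0 < e ->
  \forall p \near ((0 : R), z),
    `|dmx (jac (h p.1)) p.2 (ebase l) i j - p.1 * dmx (jac V) z (ebase l) i j|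
      <= e * `|p.1|.
Proof.
move=> Dz e0.
have sH : smooth_open O (Hc i j l) by do 2 apply: smooth_open_derive.
have near_disc : \forall p \near ((0 : R), z), disc p.2.
  apply: cvg_snd; apply: open_nbhs_nbhs; split => //; exact: open_disc.
apply: filterS2 near_disc (local_time_taylor sH Dz e0) => -[t w] /= Dw.
by rewrite HcE Hc0// subr0 Hc_time.
Qed.

End CurveEstimates.

(** * Quantitative estimates for matrices near the identity *)

Section MatrixNorm.
Context {R : realType}.

Lemma mx_norm_entry m n (A : 'M[R]_(m, n)) i j : `|A i j| <= `|A|.
Proof.
rewrite [leRHS]mx_normrE; exact: (le_bigmax _ (fun p => `|A p.1 p.2|) (i, j)).
Qed.

Lemma mx_norm_le m n (A : 'M[R]_(m, n)) (c : R) :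
  0 <= c -> (forall i j, `|A i j| <= c) -> `|A| <= c.
Proof. by move=> c0 Ac; rewrite [leLHS]mx_normrE; apply: bigmax_le. Qed.

(** The norm is the largest absolute value of an entry; the factor [n] counts the summands in an
    entry of the product. *)
Lemma mx_normM m n p (A : 'M[R]_(m, n)) (B : 'M[R]_(n, p)) :
  `|A *m B| <= n%:R * (`|A| * `|B|).
Proof.
apply: mx_norm_le => [|i j]; first by rewrite !mulr_ge0.
rewrite mxE (le_trans (ler_norm_sum _ _ _))//.
rewrite (@le_trans _ _ (\sum_(k < n) (`|A| * `|B|)))//.
  by apply: ler_sum => k _; rewrite normrM ler_pM// mx_norm_entry.
by rewrite sumr_const card_ord mulr_natl.
Qed.

Lemma mx_norm1 n : `|1%:M : 'M[R]_n| <= 1.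
Proof.
apply: mx_norm_le => // i j; rewrite mxE.
by case: (_ == _); rewrite ?normr1 ?normr0.
Qed.

(** The bound 1/4 offsets the factor 2 of [mx_normM], so that multiplying by [J - 1] at least halves
    the norm. The kernel matrix K satisfies K = - K (J - 1), so it vanishes; and X = [invmx J]
    satisfies X - 1 = - X (J - 1), whence |X| <= |X| / 2 + 1. *)
Lemma invmx_near1 (J : 'M[R]_2) : `|J - 1%:M| <= 4^-1 ->
  [/\ J \in unitmx, `|invmx J| <= 2 & `|invmx J - 1%:M| <= 4 * `|J - 1%:M|].
Proof.
move=> J1; have uJ : J \in unitmx.
  rewrite -row_free_unit -kermx_eq0 -normr_le0.
  have NE : kermx J = - (kermx J *m (J - 1%:M)).
    by rewrite mulmxBr mulmx_ker mulmx1 sub0r opprK.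
  have NJ := mx_normM (kermx J) (J - 1%:M); rewrite -normrN -NE in NJ.
  have real_arith (a b : R) : b <= a * 4^-1 -> a <= 2 * b -> a <= 0 by lra.
  exact: real_arith (ler_wpM2l (normr_ge0 (kermx J)) J1) NJ.
have XE : invmx J - 1%:M = - (invmx J *m (J - 1%:M)).
  by rewrite mulmxBr mulVmx// mulmx1 opprB.
have X1 : `|invmx J - 1%:M| <= 2 * (`|invmx J| * `|J - 1%:M|).
  by rewrite XE normrN mx_normM.
have X2 : `|invmx J| <= 2.
  have real_arith (a b c d : R) :
    c <= 2 * b -> b <= a * 4^-1 -> d <= 1 -> a <= c + d -> a <= 2 by lra.
  apply: (real_arith _ _ _ _ X1 (ler_wpM2l (normr_ge0 (invmx J)) J1) (mx_norm1 2)).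
  by rewrite -{1}(subrK 1%:M (invmx J)) ler_normD.
split => //; rewrite (le_trans X1)//.
have real_arith (a b : R) : a <= 2 * b -> 2 * a <= 4 * b by lra.
exact: real_arith (ler_wpM2r (normr_ge0 (J - 1%:M)) X2).
Qed.

(** This is the estimate for theta(h_t), with [J] and [H] the Jacobian and its derivative. The
    argument gives constants 4 and 8; 40 is the one needed in [pullback_near1], shared for
    uniformity. *)
Lemma mulmx_invmx_near1 (J H : 'M[R]_2) (b : R) :
  b <= 4^-1 -> `|J - 1%:M| <= b -> `|H| <= b ->
  `|invmx J *m H| <= 40 * b /\ `|invmx J *m H - H| <= 40 * b ^+ 2.
Proof.
move=> b4 Jb Hb; have [_ X2 X1] := invmx_near1 (le_trans Jb b4).
have b0 : 0 <= b by exact: le_trans Hb.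
have X1b : `|invmx J - 1%:M| <= 4 * b by rewrite (le_trans X1)// ler_pM2l.
split.
  have real_arith (a : R) : a <= 2 * b -> 2 * a <= 40 * b by lra.
  rewrite (le_trans (mx_normM _ _))//.
  exact: real_arith (ler_pM (normr_ge0 _) (normr_ge0 _) X2 Hb).
have real_arith (a : R) : a <= 4 * b * b -> 2 * a <= 40 * b ^+ 2.
  by have := sqr_ge0 b; rewrite expr2 -mulrA; lra.
rewrite -{2}(mul1mx H) -mulmxBl (le_trans (mx_normM _ _))//.
exact: real_arith (ler_pM (normr_ge0 _) (normr_ge0 _) X1b Hb).
Qed.

(** Up to sign, [Z] is theta of the inverse map. The sum S(X) is linear in X = [invmx J] and S(1) =
    [H l], so [Z - H l] equals S(X)(X - 1) + S(X - 1), bounded by 32 b^2 + 8 b^2. *)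
Lemma pullback_near1 (J : 'M[R]_2) (H : 'I_2 -> 'M[R]_2) (l : 'I_2) (b : R) :
  b <= 4^-1 -> `|J - 1%:M| <= b -> (forall m, `|H m| <= b) ->
  let Z := (\sum_m invmx J m l *: H m) *m invmx J in
  `|Z| <= 40 * b /\ `|Z - H l| <= 40 * b ^+ 2.
Proof.
move=> b4 Jb Hb Z; have [_ X2 X1] := invmx_near1 (le_trans Jb b4).
have b0 : 0 <= b by exact: le_trans (Hb l).
have X1b : `|invmx J - 1%:M| <= 4 * b by rewrite (le_trans X1)// ler_pM2l.
pose S (X : 'M[R]_2) := \sum_m X m l *: H m.
have S_le (X : 'M[R]_2) (c : R) : `|X| <= c -> `|S X| <= 2 * (c * b).
  move=> Xc; rewrite (le_trans (ler_norm_sum _ _ _))//.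
  rewrite (@le_trans _ _ (\sum_(m < 2) (c * b)))//; last first.
    by rewrite sumr_const card_ord mulr_natl.
  apply: ler_sum => m _; rewrite [leLHS]mx_normZ ler_pM//.
  exact: le_trans (mx_norm_entry _ _ _) Xc.
have SX : `|S (invmx J)| <= 4 * b by have := S_le _ _ X2; rewrite mulrA -natrM.
rewrite /Z -/(S (invmx J)); split.
  have real_arith (a : R) : a <= 4 * b * 2 -> 2 * a <= 40 * b by lra.
  rewrite (le_trans (mx_normM _ _))//.
  exact: real_arith (ler_pM (normr_ge0 _) (normr_ge0 _) SX X2).
have SE : S (invmx J) - H l = S (invmx J - 1%:M).
  have S1 : S 1%:M = H l.
    rewrite /S (bigD1 l)//= big1 ?addr0; first by rewrite mxE eqxx scale1r.
    by move=> m ml; rewrite mxE (negbTE ml) scale0r.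
  rewrite -{1}S1 /S -sumrB; apply: eq_bigr => m _.
  by rewrite -scalerBl !mxE.
have -> : S (invmx J) *m invmx J - H l =
    S (invmx J) *m (invmx J - 1%:M) + S (invmx J - 1%:M).
  by rewrite mulmxBr mulmx1 -SE addrA subrK.
rewrite (le_trans (ler_normD _ _))//.
have real_arith (x y z : R) : x <= 2 * z -> z <= 4 * b * (4 * b) ->
    y <= 2 * (4 * b * b) -> x + y <= 40 * b ^+ 2.
  by have := sqr_ge0 b; rewrite expr2; clear; nra.
exact: (real_arith _ _ _ (mx_normM _ _)
  (ler_pM (normr_ge0 _) (normr_ge0 _) SX X1b) (S_le _ _ X1b)).
Qed.

End MatrixNorm.

(** * The inverse diffeomorphism on the open disc and its Jacobian *)

Section DiscDiffeo.
Context {R : realType}.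
Local Notation plane := (R * R)%type.

Lemma smooth_open_jac (f : plane -> plane) i j :
  smooth_open disc f -> smooth_open disc (fun z => jac f z i j).
Proof.
move=> sf; have scf : smooth_open disc (pcoord i \o f).
  by apply: smooth_open_linear => //; [exact: pcoord_continuous|exact: open_disc].
apply: smooth_open_eq (smooth_open_derive (@ebase R j) scf); first exact: open_disc.
by move=> z _; rewrite mxE.
Qed.

Lemma derive_comp_plane (f : plane -> R) (phi : plane -> plane) (z v : plane) :
  differentiable f (phi z) -> differentiable phi z ->
  'D_v (f \o phi) z =
  \sum_m 'D_(ebase m) f (phi z) * 'D_v (fun w => pcoord m (phi w)) z.
Proof.
move=> df dphi; have cp m := @pcoord_continuous R m.
have dp m y : differentiable (@pcoord R m) y.
  by apply: linear_differentiable; exact: cp.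
have pE m : 'D_v (fun w => pcoord m (phi w)) z = pcoord m ('d phi z v).
  rewrite deriveE; last exact: (differentiable_comp dphi (dp m (phi z))).
  have E := diff_comp dphi (dp m (phi z)).
  rewrite [X in X _ = _]E/= diff_lin//; exact: cp.
rewrite deriveE; last exact: differentiable_comp.
rewrite diff_comp//= big_ord_recl big_ord1 !pE !deriveE//.
rewrite {1}(plane_sum ('d phi z v)) linearD !linearZ.
by rewrite /= mulrC [X in _ + X]mulrC.
Qed.

Lemma circle_polar (w : plane) : circle w -> exists t, w = polar 1 t.
Proof.
case: w => x y; rewrite /circle/= => xy1.
have x1 : -1 <= x <= 1 by apply/andP; split; nra.
have sE : sin (acos x) ^+ 2 = y ^+ 2.
  by rewrite sin2cos2 acosK ?in_itv// -xy1 addrAC subrr add0r.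
move/eqP: sE; rewrite eqf_sqr => /orP[/eqP yE|/eqP yE].
- by exists (acos x); rewrite /polar !mul1r yE acosK ?in_itv.
- by exists (- acos x); rewrite /polar !mul1r sinN cosN yE opprK acosK ?in_itv.
Qed.

Variable g : plane -> plane.
Hypothesis gar : Diff_plus_ar g.
Let gi := inv_on cdisc g.

Lemma smooth_open_diff : smooth_open disc g.
Proof.
have [[[_ sg _] _] _] := gar.
exact: (smooth_on_open open_disc (@disc_cdisc R) sg).
Qed.

Lemma smooth_open_inv : smooth_open disc gi.
Proof.
have [[[_ _ sg] _] _] := gar.
exact: (smooth_on_open open_disc (@disc_cdisc R) sg).
Qed.

Lemma inv_onK z : cdisc z -> g (gi z) = z.
Proof.
have [[[bg _ _] _] _] := gar; move=> Dz.
apply: pinvK; rewrite inE; have [_ _ sg] := bg; exact: sg.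
Qed.

(* An asymptotically radial map preserves the boundary circle. *)
Lemma inv_on_disc z : disc z -> disc (gi z).
Proof.
move=> Dz; have Cz := disc_cdisc Dz.
have [[[bg _ _] _] [e [phi [/andP[e0 e1] [[[fphi _ _] _ _] _] gE]]]] := gar.
have [fg _ _] := bijpinv_bij (fun=> 0) bg.
(* If [gi z] were on the circle, the radial form at [r = 1] would put [z = g (gi z)] on the circle
   as well. *)
have := fg _ Cz; rewrite -/(gi z) /cdisc /disc/= le_eqVlt => /orP[/eqP w1|//].
have /circle_polar[t wE] : circle (gi z) by [].
have := fphi (polar 1 t); rewrite /circle/=.
rewrite !mul1r cos2Dsin2 => /(_ erefl) phi1.
have := inv_onK Cz; rewrite wE gE; last first.
  by rewrite lexx andbT ltrBlDr ltrDl.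
rewrite scale1r => zE; move: Dz; rewrite /disc/= -zE.
by rewrite phi1 ltxx.
Qed.

Lemma jac_mul_jac_inv z : disc z -> jac g (gi z) *m jac gi z = 1%:M.
Proof.
move=> Dz; have Dw := inv_on_disc Dz; apply/matrixP => i j; rewrite !mxE.
have cp m := @pcoord_continuous R m.
have dg : differentiable (pcoord i \o g) (gi z).
  apply: (@smooth_open_differentiable _ _ _ disc) => //.
  apply: smooth_open_linear;
    [exact: cp|exact: open_disc|exact: smooth_open_diff].
have dgi : differentiable gi z.
  exact: smooth_open_differentiable smooth_open_inv Dz.
transitivity ('D_(ebase j) ((pcoord i \o g) \o gi) z).
  rewrite (derive_comp_plane _ dg dgi).
  by apply: eq_bigr => m _; rewrite !mxE.
rewrite (@derive_eq_on _ _ _ disc _ (@pcoord R i) _ _ open_disc Dz); last first.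
  by move=> y Dy; rewrite /= inv_onK//; exact: disc_cdisc.
have dp : differentiable (@pcoord R i) z.
  by apply: linear_differentiable; exact: cp.
rewrite deriveE// (diff_lin _ (cp i)); exact: pcoord_ebase.
Qed.

Lemma jac_unit z : disc z -> jac g z \in unitmx.
Proof.
by have [[_ dg] _] := gar => /dg; rewrite unitmxE unitfE => /lt0r_neq0.
Qed.

Lemma jac_inv_unit z : disc z -> jac gi z \in unitmx.
Proof. by move=> /jac_mul_jac_inv/mulmx1_unit[]. Qed.

Lemma jac_invE z : disc z -> jac gi z = invmx (jac g (gi z)).
Proof.
move=> Dz; have uJ := jac_unit (inv_on_disc Dz).
by rewrite -[LHS](mulKmx uJ) jac_mul_jac_inv// mulmx1.
Qed.

(* Differentiating [jac g (gi z) *m jac gi z = 1] along [ebase l]. *)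
Lemma theta_inv z l : disc z ->
  let X := invmx (jac g (gi z)) in
  theta gi z (ebase l) =
  - ((\sum_m X m l *: dmx (jac g) (gi z) (ebase m)) *m X).
Proof.
move=> Dz X; have Dw := inv_on_disc Dz.
have dgi : differentiable gi z.
  exact: smooth_open_differentiable smooth_open_inv Dz.
have dJ i j : differentiable (fun w => jac g w i j) (gi z).
  apply: (smooth_open_differentiable (smooth_open_jac _ _ smooth_open_diff)).
  exact: Dw.
have dJgi i j : differentiable (fun w => jac g (gi w) i j) z.
  exact: (differentiable_comp dgi (dJ i j)).
have dJi i j : differentiable (fun w => jac gi w i j) z.
  exact: (smooth_open_differentiable (smooth_open_jac _ _ smooth_open_inv)).
set Y := \sum_m _.
have XE : jac gi z = X by exact: jac_invE.
have DJ i m : 'D_(ebase l) (fun w => jac g (gi w) i m) z = Y i m.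
  rewrite [LHS](derive_comp_plane _ (dJ i m) dgi) /Y summxE.
  by apply: eq_bigr => k _; rewrite -XE !mxE mulrC.
have product_rule : jac g (gi z) *m dmx (jac gi) z (ebase l) = - (Y *m X).
  apply/eqP; rewrite -addr_eq0; apply/eqP/matrixP => i j.
  rewrite !mxE -big_split/=.
  transitivity ('D_(ebase l)
      (\sum_m (fun w => jac g (gi w) i m) * (fun w => jac gi w m j)) z).
    rewrite derive_sum; last first.
      by move=> m; apply: derivableM; exact: diff_derivable.
    apply: eq_bigr => m _.
    rewrite deriveM; [|exact: diff_derivable|exact: diff_derivable].
    by rewrite DJ -XE [dmx _ _ _ _ _]mxE /GRing.scale/= [_ * Y i m]mulrC.
  rewrite (@derive_eq_on _ _ _ disc _ (cst ((i == j)%:R : R)) _ _ open_disc Dz).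
    by rewrite derive_cst.
  move=> y Dy; have := congr1 (fun A : 'M[R]_2 => A i j) (jac_mul_jac_inv Dy).
  rewrite !mxE => <-.
  by rewrite fct_sumE.
(* Since [jac gi z] is [X], the left factor of theta is [jac g (gi z)], and the claim is
   [product_rule]. *)
rewrite /theta XE /X invmxK; exact: product_rule.
Qed.

End DiscDiffeo.

(** * Open sets in the product sigma-algebra; finite area of the disc *)

Section PlaneMeasurability.
Context {R : realType}.

Local Notation mplane := (measurableTypeR R * measurableTypeR R)%type.

(** An open set is the union of the countably many boxes with rational centre and radius 1/(n+1)
    that it contains. *)
Lemma open_measurable_plane (U : set (R * R)) :
  open U -> measurable (U : set mplane).
Proof.
move=> oU.
pose box (p : rat * rat * nat) : set mplane :=
  ball (ratr p.1.1 : R) p.2.+1%:R^-1 `*` ball (ratr p.1.2 : R) p.2.+1%:R^-1.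
(* [B p] is the box if it fits in [U] and empty otherwise, so the union can run over the whole
   countable index type. *)
pose B p : set mplane := [set z | box p `<=` U /\ box p z].
have -> : U = \bigcup_p B p.
  apply/seteqP; split => [z Uz|z [p _ [pU pz]]]; last exact: pU.
  have /nbhs_ballP[r /= r0 rU] : nbhs z U by exact: open_nbhs_nbhs.
  have r20 : 0 < r / 2 by rewrite divr_gt0.
  have [n _ /(_ n (leqnn n))/= nr] := near_infty_natSinv_lt (PosNum r20).
  have dense (x : R) : exists q : rat, ball (ratr q : R) n.+1%:R^-1 x.
    have n0 : 0 < n.+1%:R^-1 :> R by rewrite invr_gt0.
    have /rat_in_itvoo[q] : x - n.+1%:R^-1 < x + n.+1%:R^-1.
      by rewrite ltrBlDr -addrA ltrDl addr_gt0.
    rewrite in_itv/= => /andP[q1 q2]; exists q.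
    by rewrite -ball_normE/= distrC ltr_distlC q1 q2.
  have [[a Ha] [b Hb]] := (dense z.1, dense z.2).
  exists (a, b, n) => //; split => // y [/= y1 y2]; apply: rU.
  have near_center (q u v : R) :
      ball q n.+1%:R^-1 u -> ball q n.+1%:R^-1 v -> ball u r v.
    rewrite -!ball_normE/= => qu qv; rewrite (le_lt_trans (ler_distD q _ _))//.
    by rewrite (splitr r) distrC ltrD// (lt_trans _ nr).
  by split; [exact: near_center Ha y1|exact: near_center Hb y2].
apply: countable_bigcupT_measurable => [|p]; first exact: countableP.
have [pU|pU] := pselect (box p `<=` U).
  rewrite (_ : B p = box p).
    by apply: measurableX; exact: measurable_ball.
  by apply/seteqP; split => z; [case|].
by rewrite (_ : B p = set0)//; apply/seteqP; split => z // [].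
Qed.

Lemma open_continuous_measurable_plane (U : set (R * R)) (f : R * R -> R) :
  open U -> (forall z, U z -> {for z, continuous f}) ->
  measurable_fun (U : set mplane) (f : mplane -> R).
Proof.
move=> oU cf; apply: (measurability _ (RGenOpens.measurableE R)).
move=> _ [_ [a [b ->] <-]]; apply: open_measurable_plane.
rewrite openE => z [Uz fz]; rewrite /interior; apply: filterI.
  exact: open_nbhs_nbhs.
apply: (cf z Uz); apply: open_nbhs_nbhs; split => //; exact: interval_open.
Qed.

Lemma measurable_disc : measurable (disc : set mplane).
Proof. by apply: open_measurable_plane; exact: open_disc. Qed.

Lemma disc_finite_measure :
  ((@lebesgue_measure R \x @lebesgue_measure R) (disc : set mplane) < +oo)%E.
Proof.
have mI : measurable (`[(-1), 1]%classic : set (measurableTypeR R)).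
  exact: measurable_itv.
apply: (@le_lt_trans _ _ ((@lebesgue_measure R \x @lebesgue_measure R)%E
   (`[(-1), 1]%classic `*` `[(-1), 1]%classic))).
  apply: le_measure; rewrite ?inE; [exact: measurable_disc|exact: measurableX|].
  move=> z; rewrite /disc/= => z1; rewrite !in_itv/=.
  by split; apply/andP; split; nra.
have LE : lebesgue_measure (`[(-1), 1]%classic : set R) = (1 - -1)%:E.
  have lt11 : -1 < 1 :> R by lra.
  by rewrite lebesgue_measure_itv/= lte_fin lt11 -EFinB.
rewrite product_measure1E//; apply: (@le_lt_trans _ _ ((1 - -1)%:E * (1 - -1)%:E)%E).
  by rewrite -{1}LE -{1}LE.
by rewrite -EFinM ltry.
Qed.

End PlaneMeasurability.

(** * Differentiation at 0 under the integral sign *)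

Section DerivativeOfIntegral.
Context d (T : measurableType d) {R : realType}.
Variables (mu : {measure set T -> \bar R}) (D : set T).
Hypotheses (mD : measurable D) (muD : (mu D < +oo)%E).

Lemma integrable_on_finite (f : T -> R) (C : R) :
  measurable_fun D f -> (forall z, D z -> `|f z| <= C) ->
  mu.-integrable D (EFin \o f).
Proof.
move=> mf fC; apply: measurable_bounded_integrable => //.
exists C; split; first by rewrite num_real.
by move=> M CM z Dz; exact: le_trans (fC z Dz) (ltW CM).
Qed.

(** The quotients [f s z / s] tend to [g z] and are bounded by [C], which is integrable on a set of
    finite measure. Nothing is asked about derivatives at [s] other than 0, and measurability of [g]
    follows by passing to the limit. *)
Lemma is_derive_Rintegral (f : R -> T -> R) (g : T -> R) (C : R) :
  (\forall s \near (0 : R), measurable_fun D (f s)) ->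
  (\forall s \near (0 : R), forall z, D z -> `|f s z| <= C * `|s|) ->
  (forall z, D z -> forall e, 0 < e ->
     \forall s \near (0 : R), `|f s z - s * g z| <= e * `|s|) ->
  is_derive (0 : R) 1 (fun s => \int[mu]_(z in D) f s z)
    (\int[mu]_(z in D) g z).
Proof.
move=> mf fC fg; pose I s := \int[mu]_(z in D) f s z.
(* The domination at [s = 0] forces [f 0] to vanish on [D]. *)
have I0 : I 0 = 0.
  rewrite /I (@eq_Rintegral _ _ _ _ _ (cst 0)) ?Rintegral_cst ?mul0r//.
  move=> z /set_mem Dz; have := nbhs_singleton fC z Dz.
  by rewrite normr0 mulr0 normr_le0 => /eqP.
suff cvgI : s^-1 * I s @[s --> 0^'] --> \int[mu]_(z in D) g z.
  have E : (fun s : R => s^-1 *: ((I \o shift 0) (s *: 1) - I 0)) =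
           (fun s => s^-1 * I s).
    by apply/funext => s; rewrite /= I0 subr0 addr0 [s%:A]mulr1.
  split; first by rewrite /derivable E; apply/cvg_ex; eexists; exact: cvgI.
  by rewrite /derive E; exact: cvg_lim cvgI.
(* Dominated convergence concerns sequences; the shift by [N] makes the eventual hypotheses hold for
   every index. *)
apply/cvgr_dnbhsP => u [u0 ucvg].
have [N _ HN] : \forall n \near \oo, measurable_fun D (f (u n)) /\
    forall z, D z -> `|f (u n) z| <= C * `|u n|.
  exact: (ucvg _ (filterI mf fC)).
rewrite -(cvg_shiftn N) /=.
pose F n z := (u (n + N)%N)^-1 * f (u (n + N)%N) z.
have mF n : measurable_fun D (F n).
  by apply: measurable_funM => //; have [] := HN _ (leq_addl n N).
have FC n z : D z -> `|F n z| <= C.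
  move=> Dz; have [_ /(_ z Dz)] := HN _ (leq_addl n N).
  by rewrite /F normrM normfV ler_pdivrMl ?normr_gt0// mulrC.
have Fg z : D z -> F ^~ z @ \oo --> g z.
  move=> Dz; rewrite /F (cvg_shiftn N (fun n => (u n)^-1 * f (u n) z)).
  apply/cvgrPdist_le => e e0.
  have : \forall n \near \oo, `|f (u n) z - u n * g z| <= e * `|u n|.
    exact: (ucvg _ (fg z Dz e e0)).
  apply: filterS => n H; have nun0 : 0 < `|u n| by rewrite normr_gt0.
  by rewrite -(ler_pM2l nun0) -normrM mulrBr mulVKf// distrC [leRHS]mulrC.
have mg : measurable_fun D g by exact: measurable_fun_cvg mF Fg.
have IE n : (u (n + N)%N)^-1 * I (u (n + N)%N) = \int[mu]_(z in D) F n z.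
  rewrite /F RintegralZl//; have [mfn fnC] := HN _ (leq_addl n N).
  exact: integrable_on_finite mfn fnC.
rewrite (eq_cvg _ _ IE).
have cvgFE : {ae mu, forall z, D z -> (F n z)%:E @[n --> \oo] --> (g z)%:E}.
  apply: aeW => z Dz; apply: cvg_EFin; first exact: nearW.
  exact: Fg.
have iC : mu.-integrable D (EFin \o cst C).
  by apply: (@integrable_on_finite _ `|C|) => //; exact: measurable_cst.
have FCE : {ae mu, forall z n, D z -> (`|(F n z)%:E| <= (EFin \o cst C) z)%E}.
  by apply: aeW => z n Dz; rewrite /= lee_fin; exact: FC.
have mFE n : measurable_fun D (EFin \o F n) by exact/measurable_EFinP.
have mgE : measurable_fun D (EFin \o g) by exact/measurable_EFinP.
have [ig _ cvgF] := dominated_convergence mD mFE mgE cvgFE iC FCE.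
apply: fine_cvg; rewrite fineK//.
exact: integrable_fin_num.
Qed.

End DerivativeOfIntegral.

(** * First-order expansions of matrix-valued one-forms, and their wedges *)

Section TangentForms.
Context {R : realType}.
Local Notation plane := (R * R)%type.
Local Notation mplane := (measurableTypeR R * measurableTypeR R)%type.
Local Notation mform1 := (@mform1 R).

Lemma ord2_cases (l : 'I_2) : l = 0 \/ l = 1.
Proof. by case: l => [[|[|l]] Hl]//; [left|right]; exact: val_inj. Qed.

Definition measurable_form (a : mform1) := forall l i j,
  measurable_fun (disc : set mplane) (fun z : mplane => a z (ebase l) i j).

Definition bounded_form (a : mform1) (M : R) :=
  forall z, disc z -> forall l, `|a z (ebase l)| <= M.

(* [A t = t alpha + o(t)] pointwise on the disc, with domination [O(t)]. *)
Definition tangent_form (A : R -> mform1) (alpha : mform1) :=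
  [/\ \forall t \near (0 : R), measurable_form (A t),
      exists C, \forall t \near (0 : R), bounded_form (A t) (C * `|t|) &
      forall z, disc z -> forall l e, 0 < e -> \forall t \near (0 : R),
        `|A t z (ebase l) - t *: alpha z (ebase l)| <= e * `|t|].

Definition form_opp (a : mform1) : mform1 := fun z v => - a z v.

Lemma measurable_form_opp a : measurable_form a -> measurable_form (form_opp a).
Proof.
move=> ma l i j; rewrite /form_opp; under eq_fun do rewrite mxE.
by apply: measurableT_comp => //; exact: ma.
Qed.

Lemma bounded_form_opp a M : bounded_form a M -> bounded_form (form_opp a) M.
Proof. by move=> aM z Dz l; rewrite /form_opp normrN; exact: aM. Qed.

Lemma tangent_form_opp A alpha :
  tangent_form A alpha -> tangent_form (fun t => form_opp (A t)) (form_opp alpha).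
Proof.
move=> [mA [C AC] At]; split.
- by apply: filterS mA => t; exact: measurable_form_opp.
- by exists C; apply: filterS AC => t; exact: bounded_form_opp.
- move=> z Dz l e e0; apply: filterS (At z Dz l e e0) => t.
  by rewrite /form_opp scalerN -opprD normrN.
Qed.

(** By cyclicity of the trace. The sign stays inside the form, so that factors can be exchanged
    under the integral without any integrability; this is used to bring the moving factor to the
    right. *)
Lemma tr_wedge_opp (a b : mform1) z u v :
  \tr (wedge b a z u v) = \tr (wedge a (form_opp b) z u v).
Proof.
rewrite /wedge /form_opp !mulmxN opprK !linearD !linearN/=.
by rewrite (mxtrace_mulC (b z u)) (mxtrace_mulC (b z v)) addrC.
Qed.

(** The 8 comes from two diagonal entries, two products in the wedge, and the factor 2 of
    [mx_normM]. *)
Lemma tr_wedge_bound (a b : mform1) (M c : R) z :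
  disc z -> bounded_form a M -> (forall l, `|b z (ebase l)| <= c) ->
  `|\tr (wedge a b z (ebase 0) (ebase 1))| <= 8 * (M * c).
Proof.
move=> Dz aM bc.
have ab k l : `|a z (ebase k) *m b z (ebase l)| <= 2 * (M * c).
  by rewrite (le_trans (mx_normM _ _))// ler_pM2l// ler_pM//; exact: aM.
have w4 : `|wedge a b z (ebase 0) (ebase 1)| <= 4 * (M * c).
  rewrite (le_trans (ler_normB _ _))//.
  have real_arith (x y w : R) : x <= 2 * w -> y <= 2 * w -> x + y <= 4 * w by lra.
  exact: real_arith.
rewrite /mxtrace big_ord_recl big_ord1 (le_trans (ler_normD _ _))//.
have real_arith (x y w : R) : x <= 4 * w -> y <= 4 * w -> x + y <= 8 * w by lra.
by apply: real_arith; apply: le_trans w4; exact: mx_norm_entry.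
Qed.

Lemma measurable_tr_wedge (a b : mform1) :
  measurable_form a -> measurable_form b ->
  measurable_fun (disc : set mplane)
    (fun z : mplane => \tr (wedge a b z (ebase 0) (ebase 1))).
Proof.
move=> ma mb; rewrite /mxtrace; apply: measurable_sum => i.
under eq_fun do rewrite !mxE.
by apply: measurable_funB; apply: measurable_sum => k; apply: measurable_funM.
Qed.

Lemma is_derive_int_wedge (a beta : mform1) (B : R -> mform1) (M : R) :
  measurable_form a -> bounded_form a M -> tangent_form B beta ->
  is_derive (0 : R) 1 (fun s => int_disc_tr (wedge a (B s)))
    (int_disc_tr (wedge a beta)).
Proof.
move=> ma aM [mB [C BC] Bs].
have M0 : 0 <= M.
  by apply: le_trans (normr_ge0 _) (aM (0, 0) _ 0); rewrite /disc/= expr0n/= addr0.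
apply: (@is_derive_Rintegral _ mplane R _ disc (@measurable_disc R)
  (@disc_finite_measure R) _ _ (8 * (M * C))).
- by apply: filterS mB => s mBs; exact: measurable_tr_wedge.
- apply: filterS BC => s Bsb z Dz; rewrite -!mulrA.
  by apply: tr_wedge_bound => // l; exact: Bsb.
- move=> z Dz e e0.
  (* The error is at most 8 M times that of [B s]; dividing [e] by [8 * M + 1] absorbs it even when
     [M = 0]. *)
  have M1 : 0 < 8 * M + 1 by rewrite ltr_wpDl// mulr_ge0.
  have e1 : 0 < e / (8 * M + 1) by rewrite divr_gt0.
  apply: filterS2 (Bs z Dz 0 _ e1) (Bs z Dz 1 _ e1) => s Bs0 Bs1.
  pose b : mform1 := fun z v => B s z v - s *: beta z v.
  have -> : \tr (wedge a (B s) z (ebase 0) (ebase 1)) -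
      s * \tr (wedge a beta z (ebase 0) (ebase 1)) =
      \tr (wedge a b z (ebase 0) (ebase 1)).
    rewrite -linearZ -linearB /wedge /b !mulmxBr -!scalemxAr scalerBr; congr (\tr _).
    by rewrite !opprB [LHS]addrACA [RHS]addrACA; congr (_ + _); exact: addrC.
  have bb l : `|b z (ebase l)| <= e / (8 * M + 1) * `|s|.
    by have [->|->] := ord2_cases l.
  apply: le_trans (tr_wedge_bound Dz aM bb) _.
  rewrite !mulrA ler_wpM2r// ler_pdivrMr// [leLHS]mulrC.
  by rewrite (ler_pM2l e0) lerDl.
Qed.

End TangentForms.

(** * Measurability of theta *)

Section ThetaMeasurable.
Context {R : realType}.
Local Notation plane := (R * R)%type.
Local Notation mplane := (measurableTypeR R * measurableTypeR R)%type.

Lemma det2 (A : 'M[R]_2) : \det A = A 0 0 * A 1 1 - A 0 1 * A 1 0.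
Proof.
rewrite (expand_det_row _ 0) big_ord_recl big_ord1 /cofactor !det_mx11 !mxE /=.
rewrite !expr0 mul1r expr1 mulN1r mulrN.
by congr (_ * A _ _ - A _ _ * A _ _); exact: val_inj.
Qed.

Lemma measurable_form_djac (V : plane -> plane) :
  smooth_open disc V -> measurable_form (dmx (jac V)).
Proof.
move=> sV l i j; apply: open_continuous_measurable_plane; first exact: open_disc.
move=> z Dz; have -> : (fun y => dmx (jac V) y (ebase l) i j) =
    'D_(ebase l) (fun w => jac V w i j) by apply/funext => y; rewrite mxE.
apply: smooth_open_continuous Dz; apply: smooth_open_derive.
exact: smooth_open_jac.
Qed.

Lemma measurable_form_theta (g : plane -> plane) :
  smooth_open disc g -> (forall z, disc z -> jac g z \in unitmx) ->
  measurable_form (theta g).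
Proof.
move=> sg ug l i j.
have cJ a b z : disc z -> {for z, continuous (fun w => jac g w a b)}.
  by move=> Dz; apply: smooth_open_continuous Dz; exact: smooth_open_jac.
rewrite /theta; under eq_fun do rewrite mxE.
apply: measurable_sum => k; apply: measurable_funM; last first.
  exact: measurable_form_djac.
(* Cofactor formula for the inverse: its entries are continuous in those of the Jacobian where the
   determinant is nonzero. *)
pose inv_entry (w : plane) := (\det (jac g w))^-1 *
  ((-1) ^+ (k + i) * jac g w (lift k ord0) (lift i ord0)).
apply: (@eq_measurable_fun _ _ _ _ _ inv_entry).
  move=> z /set_mem Dz; rewrite /inv_entry /invmx ug// !mxE.
  by rewrite /cofactor det_mx11 !mxE.
apply: open_continuous_measurable_plane; first exact: open_disc.
move=> z Dz; apply: continuousM; last first.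
  by apply: continuousM; [exact: cst_continuous|exact: cJ].
apply: continuousV; first by have := ug z Dz; rewrite unitmxE unitfE.
have -> : (fun w => \det (jac g w)) =
    (fun w => jac g w 0 0 * jac g w 1 1 - jac g w 0 1 * jac g w 1 0).
  by apply/funext => w; exact: det2.
by apply: continuousB; apply: continuousM; exact: cJ.
Qed.

End ThetaMeasurable.

(** * Expansion of theta along a curve and along the inverse curve *)

Section ThetaTangent.
Context {R : realType}.
Local Notation plane := (R * R)%type.
Variables (eps : R) (eps_gt0 : 0 < eps).
Variables (h : R -> plane -> plane) (V : plane -> plane).
Hypothesis hh : G_curve eps h V.

Lemma near_Diff_plus_ar : \forall t \near (0 : R), Diff_plus_ar (h t).
Proof.
have [_ hG _ _] := hh; apply/nbhs_ballP; exists eps => //= t.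
rewrite -ball_normE/= sub0r normrN ltr_norml => te.
by have [] := hG t te.
Qed.

(** Each entrywise bound holds for all large [C], so intersecting finitely many filter sets yields
    one constant. *)
Lemma curve_bounds : exists C, \forall t \near (0 : R),
  Diff_plus_ar (h t) /\ forall z, disc z ->
  [/\ `|h t z - z| <= C * `|t|, `|jac (h t) z - 1%:M| <= C * `|t| &
      forall l, `|dmx (jac (h t)) z (ebase l)| <= C * `|t| ].
Proof.
have BJ : \forall C \near +oo, forall (p : 'I_2 * 'I_2),
    \forall t \near (0 : R), forall z, disc z ->
    `|(jac (h t) z - 1%:M) p.1 p.2| <= C * `|t|.
  by apply: filter_forall => p; exact: (curve_jac_bound eps_gt0 hh).
have BH : \forall C \near +oo, forall (p : 'I_2 * 'I_2 * 'I_2),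
    \forall t \near (0 : R), forall z, disc z ->
    `|dmx (jac (h t)) z (ebase p.2) p.1.1 p.1.2| <= C * `|t|.
  by apply: filter_forall => p; exact: (curve_djac_bound eps_gt0 hh).
have C0 : \forall C \near +oo, 0 <= C :> R.
  exact: (nbhs_pinfty_ge (num_real _)).
have [C [[C_ge0 HV] [HJ HH]]] := filter_ex
  (filterI (filterI C0 (curve_C0_bound eps_gt0 hh)) (filterI BJ BH)).
exists C; near=> t; split; first by near: t; exact: near_Diff_plus_ar.
have HtJ (p : 'I_2 * 'I_2) : forall z, disc z ->
    `|(jac (h t) z - 1%:M) p.1 p.2| <= C * `|t|.
  by move: p; near: t; apply: filter_forall => p; exact: HJ.
have HtH (p : 'I_2 * 'I_2 * 'I_2) : forall z, disc z ->
    `|dmx (jac (h t)) z (ebase p.2) p.1.1 p.1.2| <= C * `|t|.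
  by move: p; near: t; apply: filter_forall => p; exact: HH.
move=> z Dz; split.
- by move: z Dz; near: t.
- by apply: mx_norm_le => [|i j]; [exact: mulr_ge0|exact: (HtJ (i, j))].
- move=> l; apply: mx_norm_le => [|i j]; first exact: mulr_ge0.
  exact: (HtH (i, j, l)).
Unshelve. all: by end_near. Qed.

Lemma curve_djac_along (w : R -> plane) z l e :
  disc z -> 0 < e -> w t @[t --> (0 : R)] --> z ->
  \forall t \near (0 : R),
    `|dmx (jac (h t)) (w t) (ebase l) - t *: dmx (jac V) z (ebase l)| <= e * `|t|.
Proof.
move=> Dz e0 wz.
have cvgp : (t, w t) @[t --> (0 : R)] --> ((0 : R), z).
  exact: (@cvg_pair _ _ _ (nbhs (0 : R)) (nbhs (0 : R)) (nbhs z) _ _ _ id w).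
have H (p : 'I_2 * 'I_2) : \forall t \near (0 : R),
    `|dmx (jac (h t)) (w t) (ebase l) p.1 p.2
      - t * dmx (jac V) z (ebase l) p.1 p.2| <= e * `|t|.
  exact: (cvgp _ (curve_djac_taylor eps_gt0 hh p.1 p.2 l Dz e0)).
apply: filterS (filter_forall _ H) => t Ht.
apply: mx_norm_le => [|i j]; first by rewrite mulr_ge0// ltW.
have E (A B : 'M[R]_2) : (A - t *: B) i j = A i j - t * B i j by rewrite !mxE.
by rewrite E; exact: (Ht (i, j)).
Qed.

Lemma near_linear_small (C c : R) : 0 < c -> \forall t \near (0 : R), C * `|t| <= c.
Proof.
move=> c0; have C1 : 0 < `|C| + 1 by rewrite ltr_wpDl.
apply/nbhs_ballP; exists (c / (`|C| + 1)); first by rewrite /= divr_gt0.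
move=> t; rewrite -ball_normE/= sub0r normrN ltr_pdivlMr// => tc.
apply: le_trans (ltW tc); rewrite mulrC ler_wpM2l// (le_trans (ler_norm _))//.
by rewrite lerDl.
Qed.

(** Here [C * |t|] is the [b] of the matrix estimates: it must be at most 1/4, and the quadratic
    error must be o(t). *)
Lemma near_small (C e : R) : 0 < e -> \forall t \near (0 : R),
  C * `|t| <= 4^-1 /\ 40 * (C * `|t|) ^+ 2 <= e * `|t|.
Proof.
move=> e0; have c4 : 0 < 4^-1 :> R by rewrite invr_gt0.
apply: filterS2 (near_linear_small C c4) (near_linear_small (40 * C ^+ 2) e0).
move=> t tC /(ler_wpM2r (normr_ge0 t)) tC2; split => //; apply: le_trans tC2.
by rewrite exprMn [`|t| ^+ 2]expr2 !mulrA.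
Qed.

Lemma theta_tangent :
  tangent_form (fun t => theta (h t)) (dmx (jac V)).
Proof.
have [C HC] := curve_bounds; split.
- apply: filterS near_Diff_plus_ar => t gar; apply: measurable_form_theta.
    exact: smooth_open_diff.
  by move=> z; exact: jac_unit.
- exists (40 * C); apply: filterS2 (near_small C ltr01) HC => t [b4 _] [_ Ct] z Dz l.
  have [_ Jb Hb] := Ct z Dz; rewrite -mulrA.
  by have [] := mulmx_invmx_near1 b4 Jb (Hb l).
- move=> z Dz l e e0; have e20 : 0 < e / 2 by rewrite divr_gt0.
  have zz : (fun=> z) t @[t --> (0 : R)] --> z by exact: cvg_cst.
  apply: filterS3 (curve_djac_along l Dz e20 zz) HC (near_small C e20).
  move=> t Ht [_ Ct] [b4 Qt]; have [_ Jb Hb] := Ct z Dz.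
  have [_ Z2] := mulmx_invmx_near1 b4 Jb (Hb l).
  (* The error splits at [dmx (jac (h t)) z]: replacing theta by it costs O(t^2), expanding it costs
     o(t). *)
  rewrite -(subrKA (dmx (jac (h t)) z (ebase l))) (le_trans (ler_normD _ _))//.
  by rewrite (splitr e) mulrDl lerD// (le_trans Z2).
Qed.

(** The displacement bound for [h t], applied at w = h_t^-1(z), reads |z - w| <= C |t|. *)
Lemma inv_curve_cvg z : disc z -> inv_on cdisc (h t) z @[t --> (0 : R)] --> z.
Proof.
move=> Dz; have [C HC] := curve_bounds.
apply/cvgrPdist_le => e e0.
apply: filterS2 HC (near_linear_small C e0) => t [gar Ct] Ce.
have Dw := inv_on_disc gar Dz; have [+ _ _] := Ct _ Dw.
rewrite inv_onK//; last exact: disc_cdisc.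
by move=> /le_trans; apply.
Qed.

(** As for theta(h_t), with base point w = h_t^-1(z). The domination holds at every point of the
    disc, hence at w; the expansion is only pointwise, so convergence of w to z for fixed z is
    enough. *)
Lemma theta_inv_tangent :
  tangent_form (fun t => theta (inv_on cdisc (h t))) (form_opp (dmx (jac V))).
Proof.
have [C HC] := curve_bounds; split.
- apply: filterS near_Diff_plus_ar => t gar; apply: measurable_form_theta.
    exact: smooth_open_inv.
  by move=> z; exact: jac_inv_unit.
- exists (40 * C).
  apply: filterS2 (near_small C ltr01) HC => t [b4 _] [gar Ct] z Dz l.
  have [_ Jb Hb] := Ct _ (inv_on_disc gar Dz).
  rewrite theta_inv// normrN -mulrA.
  by have [] := pullback_near1 l b4 Jb Hb.
- move=> z Dz l e e0; have e20 : 0 < e / 2 by rewrite divr_gt0.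
  apply: filterS3 (curve_djac_along l Dz e20 (inv_curve_cvg Dz)) HC
    (near_small C e20) => t Ht [gar Ct] [b4 Qt].
  have [_ Jb Hb] := Ct _ (inv_on_disc gar Dz).
  rewrite theta_inv//; have [_ Z2] := pullback_near1 l b4 Jb Hb.
  rewrite /form_opp scalerN -opprD normrN.
  rewrite -(subrKA (dmx (jac (h t)) (inv_on cdisc (h t) z) (ebase l))).
  rewrite (le_trans (ler_normD _ _))//.
  by rewrite (splitr e) mulrDl lerD// (le_trans Z2).
Qed.

End ThetaTangent.

(** * The mixed derivative and its sign *)

Section Alternation.
Context {R : realType}.
Local Notation mplane := (measurableTypeR R * measurableTypeR R)%type.
Local Notation mform1 := (@mform1 R).

Lemma int_wedge_opp (a b : mform1) :
  int_disc_tr (wedge b a) = int_disc_tr (wedge a (form_opp b)).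
Proof.
rewrite /int_disc_tr; congr (Rintegral _ _ _).
by apply/funext => z; exact: tr_wedge_opp.
Qed.

Lemma int_wedge_oppr (a b : mform1) (M N : R) :
  measurable_form a -> bounded_form a M -> measurable_form b -> bounded_form b N ->
  int_disc_tr (wedge a (form_opp b)) = - int_disc_tr (wedge a b).
Proof.
move=> ma aM mb bN; rewrite /int_disc_tr -mulN1r.
rewrite -(@RintegralZl _ mplane R _ disc
  (fun z => \tr (wedge a b z (ebase 0) (ebase 1))))//; last 2 first.
- exact: measurable_disc.
- apply: (@integrable_on_finite _ mplane R _ disc (@measurable_disc R)
    (@disc_finite_measure R) _ (8 * (M * N))).
  + exact: measurable_tr_wedge.
  + by move=> z Dz; apply: tr_wedge_bound => // l; exact: bN.
congr (Rintegral _ _ _); apply/funext => z.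
rewrite mulN1r -linearN /wedge /form_opp !mulmxN; congr (\tr _).
by rewrite opprK opprB addrC.
Qed.

(** The form [alpha] is the pointwise limit of [A t / t], bounded by [C]; the extra 1 is the error
    with [e = 1]. The admissible [t] depend on [z], the constant does not. *)
Lemma bounded_form_limit (A : R -> mform1) (alpha : mform1) :
  tangent_form A alpha -> exists M, bounded_form alpha M.
Proof.
move=> [_ [C AC] At]; exists (C + 1) => z Dz l.
have near_t : \forall t \near (0 : R)^',
    `|t *: alpha z (ebase l)| <= (C + 1) * `|t|.
  apply: nbhs_dnbhs; apply: filterS2 AC (At z Dz l 1 ltr01) => t AtC Att.
  rewrite mulrDl -(subKr (A t z (ebase l)) (t *: _)).
  by rewrite (le_trans (ler_normB _ _))// lerD//; exact: AtC.
have [t [t0]] := filter_ex (filterI (nbhs_dnbhs_neq (0 : R)) near_t).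
rewrite [X in X <= _]mx_normZ mulrC ler_pM2r//.
by rewrite normr_gt0.
Qed.

Variables (c : R) (A A' B B' : R -> mform1) (a b : mform1).
Hypotheses (ma : measurable_form a) (mb : measurable_form b).
Hypotheses (TA : tangent_form A a) (TA' : tangent_form A' (form_opp a)).
Hypotheses (TB : tangent_form B b) (TB' : tangent_form B' (form_opp b)).

(** [A], [A'] stand for theta of one curve and of its inverse, [B], [B'] for those of the other. *)
Lemma mixed_derivative_int_wedge :
  let F := fun t s : R => c * int_disc_tr (wedge (A t) (B' s))
                        - c * int_disc_tr (wedge (B s) (A' t)) in
  (\forall t \near (0 : R), derivable (F t) (0 : R) 1) /\
  is_derive (0 : R) 1 (fun t => 'D_1 (F t) (0 : R))
    (- (c *+ 2) * int_disc_tr (wedge a b)).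
Proof.
move=> F; have [M aM] := bounded_form_limit TA.
have [N bN] := bounded_form_limit TB.
(* The factor [form_opp b] arises twice: as the tangent form of [B'], and from exchanging factors to
   put [B s] on the right. *)
pose D t := c * int_disc_tr (wedge (A t) (form_opp b))
  - c * int_disc_tr (wedge (A' t) (form_opp b)).
have dF : \forall t \near (0 : R), is_derive (0 : R) 1 (F t) (D t).
  have [[mA [C AC] _] [mA' [C' AC'] _]] := (TA, TA').
  have A'_reg : \forall t \near (0 : R),
      measurable_form (A' t) /\ bounded_form (A' t) (C' * `|t|).
    exact: filterI.
  apply: filterS3 mA AC A'_reg => t mt bt [mit bit].
  have -> : F t = c \*: (fun s => int_disc_tr (wedge (A t) (B' s)))
      - c \*: (fun s => int_disc_tr (wedge (A' t) (form_opp (B s)))).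
    by apply/funext => s; rewrite /F (int_wedge_opp _ (B s)).
  apply: is_deriveB; apply: is_deriveZ.
    exact: is_derive_int_wedge mt bt TB'.
  exact: is_derive_int_wedge mit bit (tangent_form_opp TB).
split; first by apply: filterS dF => t [].
apply: (@near_eq_is_derive _ _ _ D); first by apply: filterS dF => t [].
have -> : D =
    c \*: (fun t => int_disc_tr (wedge (form_opp b) (form_opp (A t))))
  - c \*: (fun t => int_disc_tr (wedge (form_opp b) (form_opp (A' t)))).
  by apply/funext => t; rewrite /D !(int_wedge_opp (form_opp b)).
have mob := measurable_form_opp mb; have bob := bounded_form_opp bN.
have dA := is_derive_int_wedge mob bob (tangent_form_opp TA).
have dA' := is_derive_int_wedge mob bob (tangent_form_opp TA').
have X1 : int_disc_tr (wedge (form_opp b) (form_opp a)) =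
    - int_disc_tr (wedge a b).
  by rewrite -int_wedge_opp; exact: int_wedge_oppr ma aM mb bN.
have X2 : int_disc_tr (wedge (form_opp b) (form_opp (form_opp a))) =
    int_disc_tr (wedge a b).
  (* Three exchanges of factors give this identity without linearity of the integral. *)
  exact (etrans (esym (int_wedge_opp (form_opp b) (form_opp a)))
    (etrans (esym (int_wedge_opp (form_opp a) b)) (esym (int_wedge_opp b a)))).
have -> : - (c *+ 2) * int_disc_tr (wedge a b) =
    c * int_disc_tr (wedge (form_opp b) (form_opp a)) -
    c * int_disc_tr (wedge (form_opp b) (form_opp (form_opp a))).
  by rewrite X1 X2; move: (int_disc_tr _) c => x y; clear; ring.
by apply: is_deriveB; apply: is_deriveZ.
Qed.

End Alternation.

Unset Implicit Arguments.

Theorem lemma6p19 (R : realType) (c0 : R) (V W : R * R -> R * R)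
    (hV : Vect_ar V) (hW : Vect_ar W)
    (eps : R) (eps_gt0 : 0 < eps) (h k : R -> R * R -> R * R)
    (hh : G_curve eps h V) (hk : G_curve eps k W) :
  let F := fun t s : R => gamma c0 (h t) (k s) - gamma c0 (k s) (h t) in
  (\forall t \near (0 : R), derivable (F t) (0 : R) 1) /\
  is_derive (0 : R) 1 (fun t => 'D_1 (F t) (0 : R))
    (- 6%:R * c0 * int_disc_tr (wedge (dmx (jac V)) (dmx (jac W)))).
Proof.
have [[sV _ _] [sW _ _]] := (hV, hW).
have -> : - 6%:R * c0 = - (3%:R * c0 *+ 2) by clear; ring.
exact: mixed_derivative_int_wedge (measurable_form_djac sV)
  (measurable_form_djac sW) (theta_tangent eps_gt0 hh)
  (theta_inv_tangent eps_gt0 hh) (theta_tangent eps_gt0 hk)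
  (theta_inv_tangent eps_gt0 hk).
Qed.
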